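(* Run on an instance with $\lambda^*\in[1,\sigma m]$, the constant-factor approximation algorithm (described in the context) returns a final solution $x^{(T)}$ satisfying \[\|x^{(T)}\|_\infty\le16\sigma\lambda^*.\]
   Context: Resource sharing problem: finite sets $\mathcal{C}$ (customers) and $\mathcal{R}$ (resources), $n=|\mathcal{C}|$, $m=|\mathcal{R}|$; for each $C$ a nonempty closed convex $X_C\subseteq\mathbb{R}^{\mathcal{R}}_{\ge0}$; $\mathcal{X}=\sum_CX_C$ (Minkowski sum); a constant $\sigma\ge1$ and oracles $f_C:\mathbb{R}^m_{\ge0}\to X_C$ with $\langle y,f_C(y)\rangle\le\sigma\min_{x\in X_C}\langle y,x\rangle$; $\lambda^*=\min_{x\in\mathcal{X}}\|x\|_\infty$; $\log$ is the natural logarithm. Constant-factor approximation algorithm: initialize $y=\mathbb{1}\in\mathbb{R}^m$, $\epsilon=\frac1{4\sigma}$, $\Lambda=1$, $T=\lceil\log m\rceil$. For phases $t=1,\dots,T$: store $y^{(t-1)}\gets y$; then (phase body) for each customer $C$ (in a fixed order) set $\alpha=0$, $s^{(t)}_C=0$ and, while $\alpha<1$: $b\gets f_C(y)$; $\xi\gets\min\{1-\alpha,\Lambda/\|b\|_\infty\}$; $y_r\gets y_r\exp(\epsilon\xi b_r)$ for all $r$; $s^{(t)}_C\gets s^{(t)}_C+\xi b$; $\alpha\gets\alpha+\xi$; if $\|y\|_1>m\,e^{t}$, then (a restart) set $y\gets y^{(t-1)}$, $\epsilon\gets\epsilon/2$, $\Lambda\gets2\Lambda$, discard all solutions of phase $t$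 and restart the phase body of phase $t$ from the first customer. After all customers of phase $t$ are processed, $s^{(t)}=\sum_Cs^{(t)}_C$. Return $x^{(T)}=\frac1T\sum_{t=1}^Ts^{(t)}$. *)

(* Defs.v *)
From HB Require Import structures.
From mathcomp Require Import all_boot all_order all_algebra.
From mathcomp Require Import all_classical all_reals all_analysis.
Set Implicit Arguments.
Unset Strict Implicit.
Unset Printing Implicit Defensive.
Import Order.TTheory GRing.Theory Num.Theory.
Import numFieldNormedType.Exports.
Local Open Scope classical_set_scope.
Local Open Scope ring_scope.

(* Resources are indexed by 'I_m, so R^m is 'rV[R]_m; its library norm `|x|
   is the maximum norm (mx_normrE), i.e. the sup norm of x. *)

Definition nonneg_vec (R : realType) (m : nat) (x : 'rV[R]_m) : Prop :=
  forall r, 0 <= x 0 r.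

Definition dotv (R : realType) (m : nat) (y x : 'rV[R]_m) : R :=
  \sum_r y 0 r * x 0 r.

Definition norm1 (R : realType) (m : nat) (y : 'rV[R]_m) : R :=
  \sum_r `|y 0 r|.

Definition minkowski_sum (R : realType) (m : nat) (C : finType)
    (X : C -> set 'rV[R]_m) : set 'rV[R]_m :=
  [set x | exists2 g : C -> 'rV[R]_m, (forall c, X c (g c)) & x = \sum_c g c].

(* Minima are written as infima; the two agree whenever the minimum exists. *)
Definition opt_value (R : realType) (m : nat) (A : set 'rV[R]_m)
    (y : 'rV[R]_m) : R :=
  inf [set dotv y x | x in A].

Definition lambda_star (R : realType) (m : nat) (C : finType)
    (X : C -> set 'rV[R]_m) : R :=
  inf [set `|x| | x in minkowski_sum X].

Definition is_oracle (R : realType) (m : nat) (sigma : R)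
    (A : set 'rV[R]_m) (g : 'rV[R]_m -> 'rV[R]_m) : Prop :=
  forall y, nonneg_vec y -> A (g y) /\ dotv y (g y) <= sigma * opt_value A y.

Definition num_phases (R : realType) (m : nat) : nat :=
  absz (Num.ceil (ln (m%:R : R))).

Record state (R : realType) (m : nat) (C : finType) := State {
  phase : nat;                 (* t, starting from 1 *)
  eps : R;
  Lam : R;
  wt : 'rV[R]_m;               (* y *)
  wt_saved : 'rV[R]_m;         (* y^(t-1) *)
  todo : seq C;                (* current customer, then those after it *)
  alpha : R;
  part_sol : C -> 'rV[R]_m;    (* c |-> s_c^(t) *)
  phase_sols : seq 'rV[R]_m    (* s^(1), ..., s^(t-1) *)
}.

Definition init_state (R : realType) (m : nat) (C : finType) (sigma : R)
    (order : seq C) : state R m C :=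
  {| phase := 1; eps := (4 * sigma)^-1; Lam := 1;
     wt := const_mx 1; wt_saved := const_mx 1;
     todo := order; alpha := 0; part_sol := fun=> 0; phase_sols := [::] |}.

(* min{1 - alpha, Lambda / `|b|}, where Lambda / 0 is read as +oo (in the
   library a division by 0 returns 0). *)
Definition step_size (R : realType) (m : nat) (a L : R) (b : 'rV[R]_m) : R :=
  if b == 0 then 1 - a else Num.min (1 - a) (L / `|b|).

(* part_sol is zeroed at the start of every phase body rather than customer by
   customer; this is the same since order has no duplicates. *)
Definition restart_phase (R : realType) (m : nat) (C : finType)
    (order : seq C) (st : state R m C) : state R m C :=
  {| phase := phase st; eps := eps st / 2; Lam := 2 * Lam st;
     wt := wt_saved st; wt_saved := wt_saved st;
     todo := order; alpha := 0; part_sol := fun=> 0;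
     phase_sols := phase_sols st |}.

Definition while_iteration (R : realType) (m : nat) (C : finType)
    (f : C -> 'rV[R]_m -> 'rV[R]_m) (order : seq C) (c : C)
    (st : state R m C) : state R m C :=
  let b := f c (wt st) in
  let xi := step_size (alpha st) (Lam st) b in
  let y := \row_r (wt st 0 r * expR (eps st * xi * b 0 r)) in
  if m%:R * expR (phase st)%:R < norm1 y then restart_phase order st
  else {| phase := phase st; eps := eps st; Lam := Lam st;
          wt := y; wt_saved := wt_saved st;
          todo := todo st; alpha := alpha st + xi;
          part_sol := fun d => if d == c then part_sol st d + xi *: b
                               else part_sol st d;
          phase_sols := phase_sols st |}.

Definition next_customer (R : realType) (m : nat) (C : finType)
    (rest : seq C) (st : state R m C) : state R m C :=
  {| phase := phase st; eps := eps st; Lam := Lam st;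
     wt := wt st; wt_saved := wt_saved st;
     todo := rest; alpha := 0; part_sol := part_sol st;
     phase_sols := phase_sols st |}.

Definition next_phase (R : realType) (m : nat) (C : finType)
    (order : seq C) (st : state R m C) : state R m C :=
  {| phase := (phase st).+1; eps := eps st; Lam := Lam st;
     wt := wt st; wt_saved := wt st;
     todo := order; alpha := 0; part_sol := fun=> 0;
     phase_sols := rcons (phase_sols st) (\sum_c part_sol st c) |}.

Definition halted (R : realType) (m : nat) (C : finType)
    (st : state R m C) : bool :=
  (num_phases R m < phase st)%N.

Definition alg_step (R : realType) (m : nat) (C : finType)
    (f : C -> 'rV[R]_m -> 'rV[R]_m) (order : seq C)
    (st : state R m C) : state R m C :=
  if halted st then st else
  match todo st with
  | [::] => next_phase order st
  | c :: rest => if alpha st < 1 then while_iteration f order c st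
                 else next_customer rest st
  end.

(* For m = 1 there is no phase, and the result is 0 since 0^-1 = 0. *)
Definition final_solution (R : realType) (m : nat) (C : finType)
    (st : state R m C) : 'rV[R]_m :=
  ((num_phases R m)%:R : R)^-1 *: \sum_(s <- phase_sols st) s.

(* The run started from the initial state halts, with final solution x. *)
Definition alg_returns (R : realType) (m : nat) (C : finType) (sigma : R)
    (f : C -> 'rV[R]_m -> 'rV[R]_m) (order : seq C) (x : 'rV[R]_m) : Prop :=
  exists k : nat,
    let st := iter k (alg_step f order) (init_state m sigma order) in
    halted st /\ x = final_solution st.

(* Main.v *)
Require Import Defs.
From HB Require Import structures.
From mathcomp Require Import all_boot all_order all_algebra.
From mathcomp Require Import all_classical all_reals all_analysis.
From mathcomp Require Import ring lra.
Import Order.TTheory GRing.Theory Num.Theory.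
Import numFieldNormedType.Exports.
Local Open Scope classical_set_scope.
Local Open Scope ring_scope.

Set Implicit Arguments.
Unset Strict Implicit.
Unset Printing Implicit Defensive.

(* Multiplicative weights.  Since [eps * Lam = 1 / (4 * sigma)], every update
   satisfies [exp (eps * xi * b_r) <= 1 + 2 * eps * xi * b_r], and the oracle
   guarantee yields, at any time during a phase started with weights y0,
     |y|_1 <= |y0|_1 + 2 * eps * sigma * \sum_c opt_c(y)
           <= |y0|_1 + 2 * eps * sigma * lambda * |y|_1,
   where opt_c(y) is monotone in y.  Hence no restart happens once
   [Lam >= lambda], so [Lam <= 2 * lambda] throughout.  As eps only decreases,
   [eps * \sum_t s^(t)_r <= ln y_r <= ln m + T <= 2 * T] at the end, and
   [1 / eps = 4 * sigma * Lam <= 8 * sigma * lambda] gives the bound. *)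

(** * Norms of row vectors and the exponential weight update *)

Section RowVectors.
Context {R : realType} {m : nat}.
Implicit Types (x y b : 'rV[R]_m) (e : R).

(** From [expR (- t) >= 1 - t] one gets [expR t * (1 - t) <= 1], and [1 <= (1 + 2 * t) * (1 - t)] on
    the interval from 0 to 1/2. *)
Lemma expR_le1D2x (t : R) : t <= 2^-1 -> 0 <= t -> expR t <= 1 + 2 * t.
Proof.
move=> t_le t_ge0.
have := expR_ge1Dx (- t); have := expR_gt0 t; have := expRxMexpNx_1 t.
set E := expR t; set F := expR (- t) => EF E_gt0 F_ge.
have : E * (1 - t) <= 1 by rewrite -[leRHS]EF ler_pM2l.
nra.
Qed.

Lemma rV_norm_entry_le x r : `|x 0 r| <= `|x|.
Proof.
rewrite [`|x|]mx_normrE.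
exact: (le_bigmax (0 : R) (fun ij => `|x ij.1 ij.2|) (ord0, r)).
Qed.

Lemma rV_norm_le x (M : R) : 0 <= M -> (forall r, `|x 0 r| <= M) -> `|x| <= M.
Proof.
move=> M_ge0 x_le; rewrite [`|x|]mx_normrE.
by apply: bigmax_le => // -[i r] _ /=; rewrite ord1.
Qed.

Lemma rV_norm_attained x : x != 0 -> exists r, `|x| = `|x 0 r|.
Proof.
rewrite -normr_eq0 => /mx_norm_neq0 [[i r]] /= norm_x.
by exists r; rewrite [LHS]norm_x ord1.
Qed.

Lemma norm1_nonneg y : nonneg_vec y -> norm1 y = \sum_r y 0 r.
Proof. by move=> y_ge0; apply: eq_bigr => r _; rewrite ger0_norm. Qed.

Lemma le_norm1 y r : y 0 r <= norm1 y.
Proof.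
rewrite /norm1 (bigD1 r) //=; apply: le_trans (ler_norm _) _.
by rewrite lerDl sumr_ge0.
Qed.

Lemma dotv_le_norm1 y x : nonneg_vec y -> dotv y x <= norm1 y * `|x|.
Proof.
move=> y_ge0; rewrite norm1_nonneg// mulr_suml.
apply: ler_sum => r _; apply: ler_wpM2l => //.
exact: le_trans (ler_norm _) (rV_norm_entry_le x r).
Qed.

(** With [e := eps * xi] this is convertible to the new weights in [while_iteration]. *)
Definition mw_update e y b : 'rV[R]_m := \row_r (y 0 r * expR (e * b 0 r)).

Lemma mw_update_ge e y b : 0 <= e -> nonneg_vec y -> nonneg_vec b ->
  forall r, y 0 r <= mw_update e y b 0 r.
Proof.
move=> e_ge0 y_ge0 b_ge0 r; rewrite mxE ler_peMr//.
by rewrite -[leLHS]expR0 ler_expR mulr_ge0.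
Qed.

Lemma ln_mw_update e y b r : 0 < y 0 r ->
  ln (mw_update e y b 0 r) = ln (y 0 r) + e * b 0 r.
Proof. by move=> y_gt0; rewrite mxE lnM ?posrE ?expR_gt0// expRK. Qed.

Lemma norm1_mw_update e y b : 0 <= e -> nonneg_vec y -> nonneg_vec b ->
  (forall r, e * b 0 r <= 2^-1) ->
  norm1 (mw_update e y b) <= norm1 y + 2 * e * dotv y b.
Proof.
move=> e_ge0 y_ge0 b_ge0 eb_le.
rewrite !norm1_nonneg//; last first.
  by move=> r; apply: le_trans (mw_update_ge e_ge0 y_ge0 b_ge0 r).
rewrite /dotv mulr_sumr -big_split /=; apply: ler_sum => r _; rewrite mxE.
have := expR_le1D2x (eb_le r) (mulr_ge0 e_ge0 (b_ge0 r)).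
move=> /(ler_wpM2l (y_ge0 r)) /le_trans; apply.
by rewrite le_eqVlt; apply/orP; left; apply/eqP; ring.
Qed.

End RowVectors.

(** * The step size *)

Section StepSize.
Context {R : realType} {m : nat} (a L : R) (b : 'rV[R]_m).
Hypotheses (a_lt1 : a < 1) (L_gt0 : 0 < L).

Lemma step_size_ge0 : 0 <= step_size a L b.
Proof.
rewrite /step_size; case: eqP => _; first by rewrite subr_ge0 ltW.
by rewrite le_min subr_ge0 ltW//= divr_ge0// ltW.
Qed.

Lemma step_size_le : step_size a L b <= 1 - a.
Proof. by rewrite /step_size; case: eqP => _ //; rewrite ge_min lexx. Qed.

Lemma step_size_norm_le : step_size a L b * `|b| <= L.
Proof.
rewrite /step_size; case: eqP => [->|/eqP b_neq0].
  by rewrite normr0 mulr0 ltW.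
by rewrite -ler_pdivlMr ?normr_gt0// ge_min lexx orbT.
Qed.

(** Needed for termination: a step that does not finish the customer is saturated at an entry of [b]
    of maximal modulus. *)
Lemma step_sizeP :
  step_size a L b = 1 - a \/ exists r, step_size a L b * `|b 0 r| = L.
Proof.
rewrite /step_size; case: eqP => [_|/eqP b_neq0]; first by left.
have [r norm_b] := rV_norm_attained b_neq0.
case: (leP (1 - a)) => _; [by left | right; exists r].
by rewrite -norm_b divfK// normr_eq0.
Qed.

End StepSize.

(** * Optimal oracle values and weak duality *)

Section OptValue.
Context {R : realType} {m : nat}.
Implicit Types (A : set 'rV[R]_m) (y : 'rV[R]_m).

Lemma opt_value_le A y x : (forall x, A x -> nonneg_vec x) ->
  nonneg_vec y -> A x -> opt_value A y <= dotv y x.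
Proof.
move=> A_ge0 y_ge0 Ax; apply: ge_inf; last by exists x.
exists 0 => _ [z Az <-]; apply: sumr_ge0 => r _.
by apply: mulr_ge0 => //; apply: A_ge0.
Qed.

Lemma opt_value_ge0 A y : (forall x, A x -> nonneg_vec x) -> A !=set0 ->
  nonneg_vec y -> 0 <= opt_value A y.
Proof.
move=> A_ge0 [x Ax] y_ge0; apply: lb_le_inf; first by exists (dotv y x), x.
move=> _ [z Az <-]; apply: sumr_ge0 => r _.
by apply: mulr_ge0 => //; apply: A_ge0.
Qed.

Lemma opt_value_mono A y y' : (forall x, A x -> nonneg_vec x) -> A !=set0 ->
  nonneg_vec y -> (forall r, y 0 r <= y' 0 r) ->
  opt_value A y <= opt_value A y'.
Proof.
move=> A_ge0 [x Ax] y_ge0 yy'; apply: lb_le_inf; first by exists (dotv y' x), x.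
move=> _ [z Az <-]; apply: le_trans (opt_value_le A_ge0 y_ge0 Az) _.
by apply: ler_sum => r _; apply: ler_wpM2r => //; apply: A_ge0.
Qed.

(** Weak duality: for each [x = \sum_c g c] in the Minkowski sum, the left side is at most
    [dotv y x], hence at most [norm1 y * |x|]. Dividing by [norm1 y] gives a lower bound of the set
    whose infimum is [lambda_star X]. *)
Lemma sum_opt_value_le (C : finType) (X : C -> set 'rV[R]_m) y :
  (forall c, X c !=set0) -> (forall c x, X c x -> nonneg_vec x) ->
  nonneg_vec y -> 0 < norm1 y ->
  \sum_c opt_value (X c) y <= lambda_star X * norm1 y.
Proof.
move=> X_nonempty X_nonneg y_ge0 y_gt0.
rewrite -ler_pdivrMr//; apply: lb_le_inf.
  have [g Xg] := choice X_nonempty.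
  by exists `|\sum_c g c|, (\sum_c g c) => //; exists g.
move=> _ [_ [g Xg ->] <-]; rewrite ler_pdivrMr// mulrC.
apply: le_trans (dotv_le_norm1 _ y_ge0).
have -> : dotv y (\sum_c g c) = \sum_c dotv y (g c).
  rewrite /dotv exchange_big; apply: eq_bigr => r _ /=.
  by rewrite summxE mulr_sumr.
by apply: ler_sum => c _; apply: opt_value_le => //; apply: X_nonneg.
Qed.

End OptValue.

Lemma ln_le_num_phases (R : realType) (m : nat) :
  (0 < m)%N -> ln (m%:R : R) <= (num_phases R m)%:R.
Proof.
move=> m_gt0; rewrite /num_phases natr_absz ger0_norm ?ceil_ge//.
by rewrite ceil_ge0 (lt_le_trans _ (@ln_ge0 _ _ _)) ?ltrN10// ler1n.
Qed.

(** * The invariant of the run *)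

Section Run.
Context {R : realType} {m : nat} {C : finType} (X : C -> set 'rV[R]_m).
Context (sigma : R) (f : C -> 'rV[R]_m -> 'rV[R]_m) (order : seq C).
Hypotheses (X_nonempty : forall c, X c !=set0)
  (X_nonneg : forall c x, X c x -> nonneg_vec x)
  (sigma_ge1 : 1 <= sigma)
  (f_oracle : forall c, is_oracle sigma (X c) (f c))
  (order_enum : perm_eq order (enum C))
  (lambda_ge1 : 1 <= lambda_star X)
  (m_gt0 : (0 < m)%N).
Implicit Types st : state R m C.

Local Notation lam := (lambda_star X).
Local Notation T := (num_phases R m).
Local Notation opt c y := (opt_value (X c) y).
Local Notation sols_sum st := (\sum_(s <- phase_sols st) s).
Local Notation part_sum st := (\sum_c part_sol st c).

Let sigma_gt0 : 0 < sigma. Proof. exact: lt_le_trans sigma_ge1. Qed.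
Let sigma_ge0 : 0 <= sigma. Proof. exact: ltW. Qed.
Let lam_gt0 : 0 < lam. Proof. exact: lt_le_trans lambda_ge1. Qed.
Let lam_ge0 : 0 <= lam. Proof. exact: ltW. Qed.

(** The optimal cost of the share of the phase already served. All terms use one weight vector, so
    the charge can be moved to larger weights by monotonicity. *)
Definition charge (handled todo : seq C) (a : R) (y : 'rV[R]_m) : R :=
  \sum_(c <- handled) opt c y + (if todo is c :: _ then a * opt c y else 0).

Lemma charge_le handled todo a y : order = handled ++ todo -> 0 <= a <= 1 ->
  nonneg_vec y -> charge handled todo a y <= \sum_c opt c y.
Proof.
move=> order_cat /andP[a_ge0 a_le1] y_ge0.
have opt_ge0 c : 0 <= opt c y by exact: opt_value_ge0 (@X_nonneg c) _ y_ge0.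
have -> : \sum_c opt c y = \sum_(c <- order) opt c y.
  by rewrite (perm_big _ order_enum) /= big_enum.
rewrite order_cat big_cat lerD2l; case: todo {order_cat} => [|c rest].
  by rewrite big_nil.
rewrite big_cons (le_trans (ler_piMl (opt_ge0 c) a_le1))// lerDl.
exact: sumr_ge0.
Qed.

(** [inv_eps] holds because a restart halves [eps] and doubles [Lam]. The facts on [wt_saved] are
    kept apart from those on [wt] so that a restart can fall back on them. The logarithms of the
    weights bound the solution accumulated so far, scaled by the current [eps]. *)
Record invariant st : Prop := Invariant {
  inv_phase : (0 < phase st <= T.+1)%N;
  inv_Lam : 1 <= Lam st <= 2 * lam;
  inv_eps : 4 * sigma * (eps st * Lam st) = 1;
  inv_wt : forall r, 1 <= wt st 0 r;
  inv_saved : forall r, 1 <= wt_saved st 0 r;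
  inv_norm1_wt : norm1 (wt st) <= m%:R * expR (phase st)%:R;
  inv_norm1_saved : norm1 (wt_saved st) <= m%:R * expR (phase st).-1%:R;
  inv_alpha : 0 <= alpha st <= 1;
  inv_charge : exists2 handled, order = handled ++ todo st &
    norm1 (wt st) <= norm1 (wt_saved st) +
      2 * eps st * sigma * charge handled (todo st) (alpha st) (wt st);
  inv_sols_ge0 : forall r, 0 <= sols_sum st 0 r;
  inv_part_ge0 : forall r, 0 <= part_sum st 0 r;
  inv_ln_saved : forall r, eps st * sols_sum st 0 r <= ln (wt_saved st 0 r);
  inv_ln_wt : forall r,
    eps st * (sols_sum st 0 r + part_sum st 0 r) <= ln (wt st 0 r) }.

Lemma inv_eps_gt0 st : invariant st -> 0 < eps st.
Proof.
move=> inv; have /andP[Lam_ge1 _] := inv_Lam inv.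
have : 0 < 4 * sigma * Lam st by rewrite !mulr_gt0//; lra.
move=> /pmulr_rgt0 <-; suff -> : 4 * sigma * Lam st * eps st = 1 by [].
by rewrite -[RHS](inv_eps inv); ring.
Qed.

Lemma inv_wt_nonneg st : invariant st -> nonneg_vec (wt st).
Proof. by move=> inv r; apply: le_trans (inv_wt inv r). Qed.

Lemma invariant_init : invariant (init_state m sigma order).
Proof.
have s_neq0 : sigma != 0 by exact: lt0r_neq0.
have norm1_ones : norm1 (const_mx 1 : 'rV[R]_m) = m%:R.
  under [LHS]eq_bigr do rewrite mxE normr1.
  by rewrite sumr_const card_ord.
split => //=.
- by rewrite lexx; move: lambda_ge1; lra.
- by field.
- by move=> r; rewrite mxE.
- by move=> r; rewrite mxE.
- rewrite norm1_ones ler_peMr//; have := expR_ge1Dx (1 : R); lra.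
- by rewrite norm1_ones expR0 mulr1.
- by rewrite lexx ler01.
(* With nothing handled and [alpha = 0], the charge vanishes whatever [order] is. *)
- exists [::] => //; rewrite /charge big_nil lerDl add0r.
  by case: (order) => [|c s]; rewrite ?mul0r mulr0.
- by move=> r; rewrite big_nil mxE.
- by move=> r; rewrite summxE; apply: sumr_ge0 => c _; rewrite mxE.
- by move=> r; rewrite big_nil !mxE ln1 mulr0.
- by move=> r; rewrite big_nil big1// !mxE ln1 addr0 mulr0.
Qed.

(** * One iteration of the while loop *)

Section WhileIteration.
Context (st : state R m C) (c : C) (rest : seq C).
Hypotheses (inv : invariant st) (todo_st : todo st = c :: rest)
  (alpha_lt1 : alpha st < 1).

Let b := f c (wt st).
Let xi := step_size (alpha st) (Lam st) b.
Let y := mw_update (eps st * xi) (wt st) b.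

Let Lam_gt0 : 0 < Lam st.
Proof. by have /andP[] := inv_Lam inv; lra. Qed.

Let xi_ge0 : 0 <= xi. Proof. exact: step_size_ge0. Qed.

Let eps_xi_ge0 : 0 <= eps st * xi.
Proof. by rewrite mulr_ge0// ltW// inv_eps_gt0. Qed.

Let b_ge0 : nonneg_vec b.
Proof. by have [/X_nonneg] := f_oracle c (inv_wt_nonneg inv). Qed.

Let wt_le_y r : wt st 0 r <= y 0 r.
Proof. by apply: mw_update_ge => //; apply: inv_wt_nonneg. Qed.

Let y_ge1 r : 1 <= y 0 r.
Proof. exact: le_trans (inv_wt inv r) (wt_le_y r). Qed.

Let y_ge0 : nonneg_vec y.
Proof. by move=> r; apply: le_trans (y_ge1 r). Qed.

Let new_alpha : 0 <= alpha st + xi <= 1.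
Proof.
have /andP[alpha_ge0 _] := inv_alpha inv.
by rewrite addr_ge0//= -lerBrDl step_size_le.
Qed.

(** The linearized update and the oracle guarantee bound the growth of [norm1] by [2 * eps * sigma]
    times [xi * opt c (wt st)], which is the increase of the charge at the old weights; monotonicity
    of [opt] then passes to [y]. *)
Lemma charge_update handled : order = handled ++ todo st ->
  norm1 (wt st) <= norm1 (wt_saved st) +
    2 * eps st * sigma * charge handled (todo st) (alpha st) (wt st) ->
  norm1 y <= norm1 (wt_saved st) +
    2 * eps st * sigma * charge handled (todo st) (alpha st + xi) y.
Proof.
move=> order_cat wt_le.
have wt_ge0 := inv_wt_nonneg inv; have eps_gt0 := inv_eps_gt0 inv.
have opt_mono d : opt d (wt st) <= opt d y.
  exact: opt_value_mono (@X_nonneg d) _ wt_ge0 wt_le_y.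
(* The exponent is at most [eps * Lam = 1 / (4 * sigma) <= 1/4]. *)
have eb_le r : eps st * xi * b 0 r <= 2^-1.
  have xib : xi * b 0 r <= Lam st.
    apply: le_trans (step_size_norm_le (alpha st) b Lam_gt0).
    rewrite ler_wpM2l//; apply: le_trans (rV_norm_entry_le b r).
    exact: ler_norm.
  rewrite -mulrA (le_trans (ler_wpM2l (ltW eps_gt0) xib))//.
  have := sigma_ge1; have := inv_eps inv; have := mulr_gt0 eps_gt0 Lam_gt0; nra.
have := norm1_mw_update eps_xi_ge0 wt_ge0 b_ge0 eb_le; rewrite -/y.
have [_ dot_le] := f_oracle c wt_ge0; rewrite -/b in dot_le.
move=> /le_trans; apply.
apply: le_trans (lerD wt_le (ler_wpM2l (mulr_ge0 (ler0n R 2) eps_xi_ge0) dot_le)) _.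
rewrite -addrA lerD2l /charge todo_st.
have -> : 2 * (eps st * xi) * (sigma * opt c (wt st)) =
  2 * eps st * sigma * (xi * opt c (wt st)) by ring.
rewrite -mulrDr ler_wpM2l//; first by rewrite !mulr_ge0// ltW.
rewrite -addrA -mulrDl lerD//; first exact: ler_sum.
by rewrite ler_wpM2l//; have /andP[] := new_alpha.
Qed.

(* A restart needs a growth of norm1 by a factor greater than e within the
   phase, whereas [2 * eps * sigma * lam <= 1/2] caps that factor at 2. *)
Lemma restart_Lam_le : m%:R * expR (phase st)%:R < norm1 y -> Lam st <= lam.
Proof.
move=> y_large; rewrite leNgt; apply/negP => lam_lt.
have y_gt0 : 0 < norm1 y.
  by apply: le_lt_trans y_large; rewrite mulr_ge0// expR_ge0.
have [handled order_cat /(charge_update order_cat) y_le] := inv_charge inv.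
have charge_opt := charge_le order_cat new_alpha y_ge0.
have := le_trans charge_opt (sum_opt_value_le X_nonempty X_nonneg y_ge0 y_gt0).
have eps_gt0 := inv_eps_gt0 inv.
have es_gt0 : 0 < 2 * eps st * sigma by rewrite !mulr_gt0.
move=> /(ler_wpM2l (ltW es_gt0)) charge_lam.
have half : 2 * eps st * sigma * lam <= 2^-1.
  have -> : 2^-1 = 2 * eps st * sigma * Lam st :> R.
    by have := inv_eps inv; lra.
  by rewrite ler_wpM2l// ltW.
have := ler_wpM2r (ltW y_gt0) half.
have := inv_norm1_saved inv; move: y_large.
have /andP[phase_gt0 _] := inv_phase inv.
(* The restart threshold is [M * E], with [M] the bound on the saved weights and [E >= 2], while
   [norm1 y <= M + norm1 y / 2] forces [norm1 y <= 2 * M]. *)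
rewrite -[in X in X -> _](prednK phase_gt0) -natr1 expRD.
have := expR_ge1Dx (1 : R).
have : 0 < m%:R * expR (phase st).-1%:R :> R by rewrite mulr_gt0 ?ltr0n ?expR_gt0.
rewrite mulrA; set M := m%:R * _; set E := expR 1 => M_gt0 E_ge.
have : M * 2 <= M * E by rewrite ler_pM2l//; lra.
lra.
Qed.

Lemma invariant_while : invariant (while_iteration f order c st).
Proof.
have eps_gt0 := inv_eps_gt0 inv.
have /andP[Lam_ge1 Lam_le] := inv_Lam inv.
rewrite /while_iteration -/b -/xi -[\row_r _]/y; case: ifPn => [|].
  move=> /restart_Lam_le Lam_le_lam; split => //=.
  - exact: inv_phase.
  - by apply/andP; split; lra.
  - by have := inv_eps inv; lra.
  - exact: inv_saved.
  - exact: inv_saved.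
  - apply: le_trans (inv_norm1_saved inv) _.
    by rewrite ler_wpM2l// ler_expR ler_nat leq_pred.
  - exact: inv_norm1_saved.
  - by rewrite lexx ler01.
  - exists [::] => //; rewrite /charge big_nil lerDl add0r.
    by case: (order) => [|d s]; rewrite ?mul0r mulr0.
  - exact: inv_sols_ge0.
  - by move=> r; rewrite summxE; apply: sumr_ge0 => d _; rewrite mxE.
  (* Halving [eps] halves the left side; the right side is nonnegative as saved weights are at least
     1. *)
  - move=> r; have := inv_ln_saved inv r.
    by have := ln_ge0 (inv_saved inv r); lra.
  - move=> r; rewrite big1_eq mxE addr0.
    have := inv_ln_saved inv r.
    by have := ln_ge0 (inv_saved inv r); lra.
rewrite -leNgt => y_le.
have part_sumE r :
    (\sum_d if d == c then part_sol st d + xi *: b else part_sol st d) 0 r =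
    part_sum st 0 r + xi * b 0 r.
  rewrite (bigD1 c)//= eqxx [in RHS](bigD1 c)//=.
  rewrite (eq_bigr (part_sol st)); last by move=> d /negbTE ->.
  by rewrite !mxE addrAC.
split => //=; try by case: inv.
- have [handled order_cat wt_le] := inv_charge inv.
  by exists handled => //; apply: charge_update.
- by move=> r; rewrite part_sumE addr_ge0 ?inv_part_ge0// mulr_ge0.
- move=> r; rewrite part_sumE ln_mw_update; last first.
    exact: lt_le_trans (inv_wt inv r).
  by rewrite addrA mulrDr mulrA lerD2r inv_ln_wt.
Qed.

(** The two summands are the decreases of the last two terms of [body_cost]. Either [xi = 1 - alpha]
    and the flag drops to 0, or some entry has [xi * b_r = Lam], so that [ln y_r] gains
    [eps * Lam = 1 / (4 * sigma)]. *)
Lemma while_progress :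
  1 <= (1 - (alpha st + xi < 1)%R%:R : R) +
       4 * sigma * (\sum_r ln (y 0 r) - \sum_r ln (wt st 0 r)).
Proof.
have ln_y r : ln (y 0 r) = ln (wt st 0 r) + eps st * xi * b 0 r.
  by rewrite ln_mw_update//; apply: lt_le_trans (inv_wt inv r).
have -> : \sum_r ln (y 0 r) - \sum_r ln (wt st 0 r) = \sum_r eps st * xi * b 0 r.
  by rewrite (eq_bigr _ (fun r _ => ln_y r)) big_split /= addrAC subrr add0r.
have inc_ge0 r : 0 <= eps st * xi * b 0 r by rewrite mulr_ge0.
have sum_ge0 : 0 <= \sum_r eps st * xi * b 0 r by apply: sumr_ge0.
have [xiE|[r]] := step_sizeP (alpha st) (Lam st) b.
  rewrite -/xi in xiE.
  have -> : alpha st + xi = 1 by rewrite xiE addrC subrK.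
  by rewrite ltxx subr0 lerDl mulr_ge0// mulr_ge0.
rewrite -/xi ger0_norm// => xib.
have : 4 * sigma * (eps st * xi * b 0 r) = 1.
  by rewrite -[RHS](inv_eps inv) -xib !mulrA.
have : 4 * sigma * (eps st * xi * b 0 r) <=
       4 * sigma * \sum_r eps st * xi * b 0 r.
  by rewrite ler_wpM2l ?mulr_ge0// [leRHS](bigD1 r)//= lerDl sumr_ge0.
by move=> sum_ge eb1; move: sum_ge; rewrite eb1; case: (_ < _) => /=; lra.
Qed.

End WhileIteration.

(** * Changes of customer and of phase *)

Lemma invariant_next_customer st c rest : invariant st -> todo st = c :: rest ->
  1 <= alpha st -> invariant (next_customer rest st).
Proof.
move=> inv todo_st alpha_ge1.
have alpha1 : alpha st = 1 by have /andP[] := inv_alpha inv; lra.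
split => //=; try by case: inv.
- by rewrite lexx ler01.
- have [handled order_cat wt_le] := inv_charge inv.
  (* At [alpha = 1] the partial charge of [c] is its full charge, and the next customer starts with
     charge 0. *)
  exists (rcons handled c); first by rewrite cat_rcons -todo_st.
  apply: le_trans wt_le _; rewrite /charge todo_st alpha1 mul1r.
  rewrite -cats1 big_cat big_seq1 /=.
  suff -> : (if rest is d :: _ then 0 * opt d (wt st) else 0) = 0 by rewrite addr0.
  by case: rest {todo_st} => // d s; rewrite mul0r.
Qed.

(** The current weights become the saved ones and the partial solution joins [phase_sols], so the
    old bounds on [wt] become the new bounds on [wt_saved]. *)
Lemma invariant_next_phase st : invariant st -> (phase st <= T)%N ->
  invariant (next_phase order st).
Proof.
move=> inv phase_le; split => //=; try by case: inv.
- apply: le_trans (inv_norm1_wt inv) _.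
  by rewrite ler_wpM2l// ler_expR ler_nat.
- by rewrite lexx ler01.
- exists [::] => //; rewrite /charge big_nil lerDl add0r.
  by case: (order) => [|d s]; rewrite ?mul0r mulr0.
- by move=> r; rewrite -cats1 big_cat big_seq1 /= mxE addr_ge0 ?inv_sols_ge0 ?inv_part_ge0.
- by move=> r; rewrite summxE; apply: sumr_ge0 => d _; rewrite mxE.
- by move=> r; rewrite -cats1 big_cat big_seq1 /= mxE; apply: inv_ln_wt.
- move=> r; rewrite -cats1 big_cat big_seq1 /= big1_eq !mxE addr0.
  exact: inv_ln_wt.
Qed.

Lemma invariant_step st : invariant st -> invariant (alg_step f order st).
Proof.
move=> inv; rewrite /alg_step /halted; case: ltnP => // phase_le.
case todo_st: (todo st) => [|c rest]; first exact: invariant_next_phase.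
case: ltP => alpha_1; first exact: invariant_while todo_st alpha_1.
exact: invariant_next_customer todo_st alpha_1.
Qed.

Lemma invariant_iter k :
  invariant (iter k (alg_step f order) (init_state m sigma order)).
Proof.
by elim: k => [|k IHk] /=; [exact: invariant_init | exact: invariant_step].
Qed.

(** * Termination by a decreasing potential *)

Let log_bound : R := m%:R * (ln m%:R + T.+1%:R).

Let body_cost st : R := 2 * (size (todo st))%:R + (alpha st < 1)%R%:R +
  4 * sigma * (log_bound - \sum_r ln (wt st 0 r)).

(** Exceeds the cost of any fresh phase body by at least 1. *)
Let body_bound : R := 2 * (size order)%:R + 2 + 4 * sigma * log_bound.

(* Each iteration that does not finish a customer raises some [ln y_r] by
   [eps * Lam = 1 / (4 * sigma)]; phase changes and restarts are paid for by
   the first term, as [Lam >= 1] doubles at every restart but stays [<= 2 * lam]. *)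
Definition potential st : R :=
  body_bound * (2 * lam - Lam st + (T.+1%:R - (phase st)%:R)) + body_cost st.

Lemma ln_entry_le (y : 'rV[R]_m) n r : norm1 y <= m%:R * expR n%:R -> 1 <= y 0 r ->
  ln (y 0 r) <= ln m%:R + n%:R.
Proof.
move=> y_le y_ge1; rewrite -[n%:R]expRK -lnM ?posrE ?expR_gt0 ?ltr0n//.
rewrite ler_ln ?posrE ?mulr_gt0 ?expR_gt0 ?ltr0n ?(lt_le_trans _ y_ge1)//.
exact: le_trans (le_norm1 y r) y_le.
Qed.

Lemma sum_ln_wt_bounds st : invariant st ->
  0 <= \sum_r ln (wt st 0 r) <= log_bound.
Proof.
move=> inv; apply/andP; split.
  by apply: sumr_ge0 => r _; apply: ln_ge0 (inv_wt inv r).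
have -> : log_bound = \sum_(r < m) (ln m%:R + T.+1%:R).
  by rewrite /log_bound sumr_const card_ord mulr_natl.
apply: ler_sum => r _.
apply: le_trans (ln_entry_le (inv_norm1_wt inv) (inv_wt inv r)) _.
by rewrite lerD2l ler_nat; have /andP[] := inv_phase inv.
Qed.

Lemma body_cost_ge0 st : invariant st -> 0 <= body_cost st.
Proof.
move=> inv; have /andP[_ ?] := sum_ln_wt_bounds inv.
by rewrite /body_cost !addr_ge0 ?mulr_ge0//; lra.
Qed.

Lemma body_bound_ge2 st : invariant st -> 2 <= body_bound.
Proof.
move=> inv; have /andP[? ?] := sum_ln_wt_bounds inv.
have : 0 <= 4 * sigma * log_bound by rewrite pmulr_rge0 ?mulr_gt0//; lra.
have : 0 <= (size order)%:R :> R by [].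
rewrite /body_bound; lra.
Qed.

Lemma potential_ge0 st : invariant st -> 0 <= potential st.
Proof.
move=> inv; have := body_bound_ge2 inv; have /andP[_ ?] := inv_Lam inv.
have /andP[_ phase_le] := inv_phase inv.
have : 0 <= T.+1%:R - (phase st)%:R :> R by rewrite subr_ge0 ler_nat.
have := body_cost_ge0 inv => ? ? ?.
by rewrite /potential addr_ge0// mulr_ge0//; lra.
Qed.

Lemma potential_step st : invariant st -> ~~ halted st ->
  potential (alg_step f order st) <= potential st - 1.
Proof.
move=> inv not_halted; have bound_ge2 := body_bound_ge2 inv.
have cost_ge0 := body_cost_ge0 inv.
have /andP[ln_ge0' ln_le] := sum_ln_wt_bounds inv.
rewrite /alg_step (negbTE not_halted); case todo_st: (todo st) => [|c rest].
  (* End of a phase: the phase counter releases [body_bound], and the weights are unchanged. *)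
  rewrite /potential /= /body_cost /= ltr01 todo_st /= -[(phase st).+1%:R]natr1.
  have : 0 <= (alpha st < 1)%R%:R :> R by [].
  have : 0 <= 4 * sigma * log_bound by rewrite pmulr_rge0 ?mulr_gt0//; lra.
  move=> log_ge0 flag_ge0.
  have : 2 * (size order)%:R + 2 <= body_bound by rewrite lerDl.
  by move: body_bound flag_ge0 => A; lra.
case: ltP => alpha_1; last first.
  rewrite /potential /next_customer /= /body_cost /= todo_st /= ltr01.
  by rewrite ltNge alpha_1 /= -natr1; lra.
have := while_progress c inv alpha_1.
rewrite /while_iteration -[\row_r _]/(mw_update _ _ _); case: ifPn => [y_large _|].
  (* Restart: doubling [Lam] releases [body_bound * Lam >= body_bound], which covers the fresh body
     and leaves at least 1. *)
  have /andP[Lam_ge1 _] := inv_Lam inv.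
  move: cost_ge0; rewrite /potential; set b0 := body_cost st => cost_ge0.
  have : body_cost (restart_phase order st) <= body_bound - 1.
    rewrite /body_cost /body_bound /= ltr01 /=.
    have : 0 <= 4 * sigma * \sum_r ln (wt_saved st 0 r).
      rewrite mulr_ge0 ?sumr_ge0 ?mulr_ge0//.
      by move=> r _; apply: ln_ge0 (inv_saved inv r).
    by rewrite mulrBr; lra.
  move: body_bound bound_ge2 (body_cost (restart_phase order st)) => A A_ge2 b1.
  have : A <= A * Lam st by rewrite ler_peMr//; lra.
  by rewrite /=; lra.
rewrite -leNgt => _.
rewrite /potential /= /body_cost /= todo_st alpha_1 /=.
by lra.
Qed.

Lemma run_halts :
  exists k, halted (iter k (alg_step f order) (init_state m sigma order)).
Proof.
set run := fun k => iter k (alg_step f order) (init_state m sigma order).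
apply: contrapT => never.
have decr k : potential (run k) <= potential (run 0) - k%:R.
  elim: k => [|k IHk]; first by rewrite subr0.
  have /negP not_halted : ~ halted (run k) by move=> halt; apply: never; exists k.
  have := potential_step (invariant_iter k) not_halted.
  by rewrite -/(run k) /= -natr1; lra.
(* After this many steps the potential would be negative. *)
have := decr (Num.truncn (potential (run 0))).+1.
have := potential_ge0 (invariant_iter (Num.truncn (potential (run 0))).+1).
have := truncnS_gt (potential (run 0)).
rewrite -/(run _); lra.
Qed.

(** * The bound on the returned solution *)

Lemma final_solution_le st : invariant st -> halted st ->
  `|final_solution st| <= 16 * sigma * lam.
Proof.
move=> inv; rewrite /halted => T_lt.
have phaseE : phase st = T.+1.
  by apply/eqP; rewrite eqn_leq T_lt andbT; have /andP[] := inv_phase inv.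
apply: rV_norm_le => [|r]; first by rewrite !mulr_ge0.
rewrite mxE ger0_norm; last by rewrite mulr_ge0 ?invr_ge0 ?inv_sols_ge0.
have sols_ge0 := inv_sols_ge0 inv r.
have : eps st * sols_sum st 0 r <= 2 * T%:R.
  apply: le_trans (inv_ln_saved inv r) _.
  (* The saved weights carry the index [T.+1.-1 = T], so the logarithm is at most
     [ln m + T <= 2 * T]. *)
  have := inv_norm1_saved inv; rewrite phaseE /= => saved_le.
  apply: le_trans (ln_entry_le saved_le (inv_saved inv r)) _.
  by have := ln_le_num_phases R m_gt0; lra.
move: sols_ge0; set S := sols_sum st 0 r => S_ge0 epsS.
have /andP[Lam_ge1 Lam_le] := inv_Lam inv.
have S_le : S <= 16 * sigma * lam * T%:R.
  have -> : S = 4 * sigma * Lam st * (eps st * S).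
    by rewrite -[LHS]mul1r -[X in X * S = _](inv_eps inv); ring.
  have sL_ge0 : 0 <= 4 * sigma * Lam st by rewrite !mulr_ge0//; lra.
  apply: le_trans (ler_wpM2l sL_ge0 epsS) _.
  have -> : 16 * sigma * lam * T%:R = 4 * sigma * (2 * lam) * (2 * T%:R) by ring.
  by rewrite ler_wpM2r ?mulr_ge0// ler_wpM2l// mulr_ge0.
(* Without phases the scaling factor is [0^-1 = 0], so the result is the zero vector. *)
have [T0|T_gt0] := posnP T.
  by rewrite T0 invr0 mul0r !mulr_ge0.
by rewrite mulrC ler_pdivrMr ?ltr0n.
Qed.

End Run.

Theorem theorem5 (R : realType) (m : nat) (C : finType)
    (X : C -> set 'rV[R]_m) (sigma : R)
    (f : C -> 'rV[R]_m -> 'rV[R]_m) (order : seq C)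
    (X_nonempty : forall c, X c !=set0)
    (X_closed : forall c, closed (X c))
    (X_convex : forall c, convex_set (X c))
    (X_nonneg : forall c x, X c x -> nonneg_vec x)
    (sigma_ge1 : 1 <= sigma)
    (f_oracle : forall c, is_oracle sigma (X c) (f c))
    (order_enum : perm_eq order (enum C))
    (lambda_ge1 : 1 <= lambda_star X)
    (lambda_le : lambda_star X <= sigma * m%:R) :
  (exists x, alg_returns sigma f order x) /\
  (forall x, alg_returns sigma f order x ->
     `|x| <= 16 * sigma * lambda_star X).
Proof.
have m_gt0 : (0 < m)%N.
  (* For [m = 0] the two bounds on [lambda_star X] would give [1 <= 0]. *)
  by case: m X f X_nonempty X_closed X_convex X_nonneg f_oracle lambda_ge1
    lambda_le => // *; lra.
split.
  have [k halt] := run_halts X_nonempty X_nonneg sigma_ge1 f_oracle order_enum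
    lambda_ge1 m_gt0.
  by eexists; exists k; split; [exact: halt | reflexivity].
move=> _ [k [halt ->]]; apply: final_solution_le (halt) => //.
exact: invariant_iter.
Qed.
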